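(* For the Multiple Cache Paging problem with $m>1$ caches, the competitive ratio of any online algorithm is unbounded; that is, for every online algorithm $\mathrm{ALG}$, $\sup_{R} \mathsf{F}_{\mathrm{ALG}}(R)/\mathsf{F}_{\mathrm{OPT}}(R) = \infty$, the supremum being over request sequences $R$.
   Context: Multiple Cache Paging (MCP) problem: there are $m$ caches, each of which can store $k$ of the $n$ contents in a catalog. Time is slotted. In each slot $t$ a request vector $\mathbf{r}(t)=(r_1,\dots,r_m)$ of $m$ contents arrives, and the $m$ requests must be matched bijectively with the $m$ caches (each cache serves exactly one request). If the content requested is not stored in the cache it is matched with, that cache fetches the content and ejects one of its currently stored contents; each such replacement is a fault. A request sequence is $R=(\mathbf{r}(t))_t$, and may be arbitrary (chosen by an adversary). An online algorithm makes its matching and ejection decisions at slot $t$ without knowledge of future requests; $\mathrm{OPT}$ is the optimal offline algorithm, which knows all of $R$ in advance. $\mathsf{F}_{\mathrm{ALG}}(R)$ denotes the number of faults algorithm $\mathrm{ALG}$ makes on $R$, and the competitive ratio of $\mathrm{ALG}$ is $\rho_{\mathrm{ALG}}=\max_R \mathsf{F}_{\mathrm{ALG}}(R)/\mathsf{F}_{\mathrm{OPT}}(R)$.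
   Formalization: Assumes k>1 and n>k: for k=1 a greedy matching is optimal, and for n≤k no replacement is ever forced, so the claim fails there. Caches start empty, a fetch into free space is not a fault, and a positive number of faults over zero counts as an infinite ratio. *)

(* Defs.v *)
From mathcomp Require Import all_boot all_order all_algebra perm.

Set Implicit Arguments.
Unset Strict Implicit.
Unset Printing Implicit Defensive.

(* Contents are 'I_n, caches are 'I_m. A request vector may repeat a content. *)
Definition request (m n : nat) := {ffun 'I_m -> 'I_n}.

Definition config (m n : nat) := {ffun 'I_m -> {set 'I_n}}.

(* One slot's decision d: cache j serves the request of index d.1 j, and, if it
   does not store the requested content, ejects v when d.2 j = Some v, and
   nothing when d.2 j = None. If the content is stored, d.2 j is ignored. *)
Definition decision (m n : nat) :=
  ({perm 'I_m} * {ffun 'I_m -> option 'I_n})%type.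

Definition served m n (r : request m n) (d : decision m n) (j : 'I_m) : 'I_n :=
  r (d.1 j).

Definition step m n (C : config m n) (r : request m n) (d : decision m n) :
    config m n :=
  [ffun j => let x := served r d j in
     if x \in C j then C j
     else x |: (if d.2 j is Some v then C j :\ v else C j)].

(* A cache that must fetch ejects a content that it stores; it may do without
   ejection only while it stores fewer than k contents. *)
Definition legal k m n (C : config m n) (r : request m n) (d : decision m n) :
    bool :=
  [forall j, (served r d j \notin C j) ==>
     (if d.2 j is Some v then v \in C j else #|C j| < k)].

(* Faults are replacements: a fetch into free space ejects nothing and is not
   counted. *)
Definition slot_faults m n (C : config m n) (r : request m n)
    (d : decision m n) : nat :=
  #|[set j | (served r d j \notin C j) && (d.2 j != None)]|.

Fixpoint legal_run k m n (C : config m n) (R : seq (request m n))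
    (D : seq (decision m n)) : bool :=
  match R, D with
  | [::], [::] => true
  | r :: R', d :: D' => legal k C r d && legal_run k (step C r d) R' D'
  | _, _ => false
  end.

Fixpoint run_faults m n (C : config m n) (R : seq (request m n))
    (D : seq (decision m n)) : nat :=
  match R, D with
  | r :: R', d :: D' => slot_faults C r d + run_faults (step C r d) R' D'
  | _, _ => 0
  end.

(* All caches are initially empty, for online and offline algorithms alike. *)
Definition empty_config m n : config m n := [ffun=> set0].

(* The decision at slot t (from 0) depends on the requests of slots 0..t only. *)
Definition online_schedule m n
    (f : seq (request m n) -> decision m n) (R : seq (request m n)) :
    seq (decision m n) :=
  [seq f (take t.+1 R) | t <- iota 0 (size R)].

Record online_alg (k m n : nat) := OnlineAlg {
  decide : seq (request m n) -> decision m n;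
  decide_legal :
    forall R, legal_run k (empty_config m n) R (online_schedule decide R)
}.

Definition alg_faults k m n (A : online_alg k m n) (R : seq (request m n)) :
    nat :=
  run_faults (empty_config m n) R (online_schedule (decide A) R).

(* Minimum over all legal schedules for R; the default value m * size R bounds
   the number of faults of any schedule (see opt_faultsP). *)
Definition opt_faults k m n (R : seq (request m n)) : nat :=
  \big[minn/(m * size R)%N]_(D : (size R).-tuple (decision m n)
      | legal_run k (empty_config m n) R D)
    run_faults (empty_config m n) R D.

Lemma run_faults_le m n (C : config m n) R D :
  run_faults C R D <= m * size R.
Proof.
elim: R C D => [|r R IH] C [|d D] //=.
rewrite mulnS leq_add ?IH //.
by rewrite -[X in _ <= X]card_ord; exact: max_card.
Qed.

Lemma legal_run_exists k m n (C : config m n) R : 0 < k ->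
  exists D : (size R).-tuple (decision m n), legal_run k C R D.
Proof.
move=> k0; elim: R C => [|r R IH] C; first by exists [tuple].
pose d : decision m n := (1%g, [ffun j => [pick v in C j]]).
have [D HD] := IH (step C r d).
exists [tuple of d :: D] => /=; rewrite HD andbT.
apply/forallP => j; apply/implyP => _; rewrite ffunE.
case: pickP => [v //|C0]; suff -> : C j = set0 by rewrite cards0.
by apply/setP => v; rewrite inE; exact: C0.
Qed.

Lemma opt_faultsP k m n (R : seq (request m n)) : 0 < k ->
  (exists2 D, legal_run k (empty_config m n) R D
     & run_faults (empty_config m n) R D = opt_faults k R) /\
  (forall D, legal_run k (empty_config m n) R D ->
     opt_faults k R <= run_faults (empty_config m n) R D).
Proof.
move=> k0; set C := empty_config m n.
have le_opt (D : (size R).-tuple _) : legal_run k C R D ->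
    opt_faults k R <= run_faults C R D.
  move=> HD; rewrite /opt_faults; have := mem_index_enum D.
  elim: index_enum => //= E s IH; rewrite in_cons big_cons => /orP[/eqP<-|/IH].
    by rewrite HD geq_minl.
  by case: ifP => // _; apply: leq_trans; exact: geq_minr.
split; last first.
  move=> D HD; have sD : size D == size R.
    move: (HD); elim: (R) (C) (D) => [|r R' IH] C' [|d D'] //= /andP[_ /IH].
    by rewrite eqSS.
  by have := le_opt (Tuple sD) HD.
have [D0 HD0] := legal_run_exists C R k0.
case: (@arg_minnP _ D0 (fun D : (size R).-tuple _ => legal_run k C R D)
  (fun D => run_faults C R D) HD0) => D HD Dmin.
exists D => //; apply/eqP; rewrite eqn_leq le_opt // andbT.
rewrite /opt_faults; apply: (big_ind (fun x => run_faults C R D <= x)) => //.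
- exact: run_faults_le.
- by move=> x y hx hy; rewrite leq_min hx hy.
Qed.

(* MathComp-Analysis is imported only here: its notations for sets shadow those
   of finset used above. *)
From mathcomp Require Import all_classical all_reals all_analysis.
Import Order.TTheory GRing.Theory Num.Theory.

(* Extended-real quotient: x / 0 = +oo for x > 0, and 0 / 0 = 0. *)
Definition fault_ratio (K : realType) k m n (A : online_alg k m n)
    (R : seq (request m n)) : \bar K :=
  (((alg_faults A R)%:R%:E : \bar K) / (opt_faults k R)%:R%:E)%E.

Definition competitive_ratio (K : realType) k m n (A : online_alg k m n) :
    \bar K :=
  ereal_sup (range (fault_ratio K A)).

(* Main.v *)
Require Import Defs.
From mathcomp Require Import all_boot all_order all_algebra.
From mathcomp Require Import fingroup perm.

(** Caches start empty and filling free space is not a fault, so a schedule can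
    avoid faults exactly when no cache serves more than [k] distinct contents.
    Request [a, b, ..., b] and then [c, b, ..., b]. The cache of the algorithm
    that serves [c] has served some [y], equal to [a] or [b], in the first slot.
    Requesting everywhere, one after the other, the remaining [k - 1] contents
    of a fixed set of [k + 1] makes that cache serve [k + 1] contents, hence
    fault. Offline, [y] and [c] can be sent to different caches, so that there
    is no fault and the ratio is [+oo]. *)

Set Implicit Arguments.
Unset Strict Implicit.
Unset Printing Implicit Defensive.

(** Without faults nothing is ever ejected, so the cache only grows; [F] is its final content, which
    legality keeps within [k]. *)
Lemma faultless_served k m n (C : config m n) R D (j : 'I_m) :
    #|C j| <= k -> legal_run k C R D -> run_faults C R D = 0 ->
  exists F : {set 'I_n}, [/\ #|F| <= k, C j \subset F &
    forall rd, rd \in zip R D -> served rd.1 rd.2 j \in F].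
Proof.
elim: R C D => [|r R IH] C [|d D] //= Ck; first by exists (C j); split.
case/andP=> leg legR /eqP; rewrite addn_eq0 => /andP[/eqP nf /eqP nfR].
have stepE : #|step C r d j| <= k /\ step C r d j = served r d j |: C j.
  rewrite ffunE /=; case: ifPn => xC.
    by split=> //; rewrite (setUidPr _) ?sub1set.
  move/forallP/(_ j): leg; rewrite xC /=.
  (* A miss that is not a fault forces [d.2 j = None], and then legality gives [#|C j| < k]. *)
  have := in_set0 j; rewrite -(cards0_eq nf) inE xC /=.
  by case: (d.2 j) => // _ Clt; rewrite cardsU1 xC.
have [F [Fk CF servF]] := IH _ _ stepE.1 legR nfR.
move: CF; rewrite stepE.2 subUset sub1set => /andP[xF CF].
exists F; split=> // rd; rewrite in_cons => /orP[/eqP->|] //.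
exact: servF.
Qed.

(** Never ejecting is legal: cache [j] stays inside [F j], and a missing content of [F j] makes the
    inclusion proper, which leaves free space. *)
Lemma served_faultless k m n (C F : config m n) R (P : seq {perm 'I_m}) :
    size P = size R -> (forall j, #|F j| <= k) -> (forall j, C j \subset F j) ->
    (forall (r : request m n) (p : {perm 'I_m}) j,
      (r, p) \in zip R P -> r (p j) \in F j) ->
  let D := [seq (p, [ffun=> None]) | p <- P] in
  legal_run k C R D /\ run_faults C R D = 0.
Proof.
move=> + Fk; elim: R C P => [|r R IH] C [|p P] //= [sP] CF servF.
set d : decision m n := (p, _).
have rF j : r (p j) \in F j by apply: servF; exact: mem_head.
have [j||-> ->] := IH (step C r d) P sP.
- by rewrite !ffunE /=; case: ifP => // _; rewrite subUset sub1set rF CF.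
- by move=> r' p' j rpP; apply: servF; rewrite in_cons rpP orbT.
split; last first.
  rewrite addn0; apply: eq_card0 => j.
  by rewrite inE ffunE eqxx andbF.
rewrite andbT; apply/forallP => j; apply/implyP => xC; rewrite ffunE.
apply: leq_trans (Fk j); apply/proper_card/properP; split=> //.
by exists (r (p j)); [exact: rF|exact: xC].
Qed.

(** The first two decisions do not depend on [R], so the adversary may choose [R] from them. *)
Lemma online_schedule_cons2 m n (f : seq (request m n) -> decision m n) r1 r2 R :
  exists D, size D = size R /\
    online_schedule f [:: r1, r2 & R] = [:: f [:: r1], f [:: r1; r2] & D].
Proof.
rewrite /online_schedule /= take0; eexists; split; last by [].
by rewrite size_map size_iota.
Qed.

Lemma mem_zip1 (S T : eqType) (s : seq S) (t : seq T) x :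
  size t = size s -> x \in s -> exists y, (x, y) \in zip s t.
Proof.
move=> st /(nthP x)[i ilt <-]; case: t st => [|y0 t] st; first by case: s st ilt.
exists (nth y0 (y0 :: t) i); rewrite -nth_zip //.
by apply: mem_nth; rewrite size_zip st minnn.
Qed.

Lemma exists_faulty_opt_faultless k m n (A : online_alg k m n) : 1 < m -> 1 < k -> k < n ->
  exists R, 0 < alg_faults A R /\ opt_faults k R = 0.
Proof.
case: m A => [|[|m]] // A _ k1 kn.
have : k < #|'I_n| by rewrite card_ord.
case/card_geqP=> s [us ss _].
case: s us ss => [|a [|b [|c s]]] us ss; try by move: k1; rewrite -ltnS -ss.
have /and3P[ab ac bc] : [&& a != b, a != c & b != c].
  move: us; rewrite /= !inE !negb_or.
  by case/and4P=> /and3P[-> -> _] /andP[-> _].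
set S := [:: a, b, c & s] in us ss.
set i0 : 'I_m.+2 := ord0; set i1 : 'I_m.+2 := ord_max.
pose req u : request m.+2 n := [ffun i => if i == i0 then u else b].
pose p1 := (decide A [:: req a]).1.
pose p2 := (decide A [:: req a; req c]).1.
(* [jA] is the cache that is given [c] in the second slot, and [y] is what it served in the
   first. *)
pose jA := (p2^-1)%g i0.
have p2jA : p2 jA = i0 by rewrite /jA permKV.
pose y := if p1 jA == i0 then a else b.
have yS : y \in S by rewrite /y; case: ifP; rewrite !inE eqxx ?orbT.
have cS : c \in S by rewrite !inE eqxx !orbT.
have yc : y != c by rewrite /y; case: ifP.
(* Constant request vectors reach every cache, whatever the matching. *)
pose T := [seq z <- S | (z != y) && (z != c)].
pose R := [:: req a, req c & [seq [ffun=> z] | z <- T]].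
exists R; split.
  rewrite lt0n; apply/negP => /eqP; rewrite /alg_faults.
  move: (decide_legal A R).
  have [D [sD ->]] := online_schedule_cons2 (decide A) (req a) (req c)
    [seq [ffun=> z] | z <- T].
  move=> leg nf; have [|F [Fk _ servF]] := faultless_served (j := jA) _ leg nf.
    by rewrite ffunE cards0.
  suff SF : {subset S <= F}.
    have := leq_trans (subset_leq_card (introT subsetP SF)) Fk.
    by rewrite (card_uniqP us) ss ltnn.
  have yF : y \in F.
    have := servF (req a, decide A [:: req a]); rewrite mem_head => /(_ isT).
    by rewrite /served /= ffunE.
  have cF : c \in F.
    have := servF (req c, decide A [:: req a; req c]).
    rewrite /= in_cons mem_head orbT => /(_ isT).
    by rewrite /served /= -/p2 p2jA ffunE eqxx.
  move=> z zS; case: (eqVneq z y) => [->//|zy]; case: (eqVneq z c) => [->//|zc].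
  have zT : z \in T by rewrite mem_filter zy zc.
  have [d zd] := mem_zip1 sD (map_f (fun z => [ffun=> z] : request m.+2 n) zT).
  have := servF _ _; rewrite /= => /(_ ([ffun=> z], d)).
  by rewrite !in_cons zd !orbT /served ffunE => /(_ isT).
(* Offline, the identity matching first gives [a] to [i0] and [b] to the others. So [jc] has not
   served [y] and can take [c], by a transposition in the second slot: [jc] never serves [y], the
   other caches never serve [c], and [k] contents of [S] remain for each. *)
pose jc := if y == b then i0 else i1.
pose F : config m.+2 n :=
  [ffun j => [set z in rem (if j == jc then y else c) S]].
pose P : seq {perm 'I_m.+2} := [:: 1%g, tperm i0 jc & nseq (size T) 1%g].
have inF j z : z \in S -> z != (if j == jc then y else c) -> z \in F j.
  by move=> zS zj; rewrite ffunE inE mem_rem_uniq // inE zj.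
have [||||leg nf] := @served_faultless k _ _ (empty_config m.+2 n) F R P.
- by rewrite /= size_nseq size_map.
- move=> j; rewrite ffunE cardsE (card_uniqP _) ?rem_uniq // size_rem ?ss //.
  by case: ifP.
- by move=> j; rewrite ffunE sub0set.
- have aS : a \in S by rewrite !inE eqxx.
  have bS : b \in S by rewrite !inE eqxx !orbT.
  have i01 : i0 != i1 by [].
  have yab : y != b -> y = a by rewrite /y; case: ifP => //; rewrite eqxx.
  move=> r p j; rewrite !in_cons => /or3P[/eqP[-> ->]|/eqP[-> ->]|].
  + rewrite perm1 ffunE; apply: inF; first by case: ifP.
    rewrite /jc; case: (eqVneq y b) => [->|/yab->].
      by case: (j == i0).
    case: (eqVneq j i0) => [->|ji0]; first by rewrite (negPf i01).
    by case: ifP => // _; rewrite eq_sym.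
  + rewrite ffunE (canF_eq (tpermK i0 jc)) tpermL.
    apply: inF; first by case: ifP.
    by case: (j == jc) => //; rewrite eq_sym.
  + move/(map_f fst) => /= rT.
    have : r \in [seq [ffun=> z] | z <- T].
      by move: rT; rewrite -/(unzip1 _) unzip1_zip // size_map size_nseq.
    case/mapP=> z; rewrite mem_filter => /andP[/andP[zy zc] zS] ->.
    by rewrite ffunE; apply: inF => //; case: ifP.
have [_ /(_ _ leg)] := opt_faultsP R (ltnW k1).
by rewrite nf leqn0 => /eqP.
Qed.

(* Imported only here because it shadows the finset notations used above. *)
From mathcomp Require Import all_classical all_reals all_analysis.
Import Order.TTheory GRing.Theory Num.Theory.

Theorem theorem2 (K : realType) (m k n : nat) (hm : (1 < m)%N) (hk : (1 < k)%N)
    (hn : (k < n)%N) (A : online_alg k m n) :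
  competitive_ratio K A = (+oo)%E.
Proof.
have [R [algR optR]] := exists_faulty_opt_faultless A hm hk hn.
apply/eqP; rewrite -leye_eq; apply: ereal_sup_ubound; exists R => //.
(* The inverse of 0 is [+oo] in the extended reals, so this single [R] attains the supremum. *)
by rewrite /fault_ratio optR /= inve0 gt0_muley // lte_fin ltr0n.
Qed.
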